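(* Let $a$ be a nonzero integer with $3\nmid a$, and let $n$ be a positive integer with $n\ge 3$. Then $$\begin{aligned}E_{2n,a}&\equiv\frac{2a}{3a-2}+(54a^3-99a^2+27a-81)n^3-(9a^4-27a^3-63a^2-81a-108)n^2\\&\quad-(117a^4+117a^3+111a^2-54a-108)n\pmod{3^{\mathrm{ord}_3 n+5}}.\end{aligned}$$
   Context: For a real number $a$, the sequence $\{E_{n,a}\}$ is defined by $E_{0,a}=1$ and $E_{n,a}=-a\sum_{k=1}^{\lfloor n/2\rfloor}\binom{n}{2k}E_{n-2k,a}$ for $n\ge 1$. For a prime $p$ and a positive integer $n$, $\mathrm{ord}_p n$ denotes the largest nonnegative integer $\alpha$ with $p^\alpha\mid n$. A congruence between rational numbers whose denominators are coprime to $p$ is understood modulo the given power of $p$ in the ring of such rationals (here $3a-2$ is coprime to $3$). *)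

(* Defs.v *)
From mathcomp Require Import all_boot all_order all_algebra.

Set Implicit Arguments.
Unset Strict Implicit.
Unset Printing Implicit Defensive.

Import GRing.Theory.
Local Open Scope ring_scope.

(* The recursion is course-of-values, so the values are built as a sequence:
   [Elist a n] is [:: E_{0,a}; ...; E_{n,a}].  The lemmas [E0] and [E_rec]
   below are the defining equations. *)
Definition Estep (R : comNzRingType) (a : R) (s : seq R) (n : nat) : R :=
  - a * \sum_(1 <= k < (n./2).+1) 'C(n, 2 * k)%:R * s`_(n - 2 * k).

Fixpoint Elist (R : comNzRingType) (a : R) (n : nat) : seq R :=
  if n is m.+1 then rcons (Elist a m) (Estep a (Elist a m) m.+1) else [:: 1].

Definition E (R : comNzRingType) (a : R) (n : nat) : R := (Elist a n)`_n.

Lemma size_Elist (R : comNzRingType) (a : R) (n : nat) :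
  size (Elist a n) = n.+1.
Proof. by elim: n => //= n IHn; rewrite size_rcons IHn. Qed.

Lemma nth_Elist (R : comNzRingType) (a : R) (m n : nat) :
  (m <= n)%N -> (Elist a n)`_m = E a m.
Proof.
elim: n => [|n IHn]; first by rewrite leqn0 => /eqP ->.
rewrite leq_eqVlt => /orP[/eqP -> //|le_mn].
by rewrite /= nth_rcons size_Elist le_mn IHn.
Qed.

Lemma E0 (R : comNzRingType) (a : R) : E a 0 = 1.
Proof. by []. Qed.

Lemma E_rec (R : comNzRingType) (a : R) (n : nat) : (0 < n)%N ->
  E a n = - a * \sum_(1 <= k < (n./2).+1) 'C(n, 2 * k)%:R * E a (n - 2 * k).
Proof.
case: n => // n _.
rewrite {1}/E /= nth_rcons size_Elist ltnn eqxx /Estep.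
congr (_ * _); apply: eq_big_nat => k /andP[k_gt0 _].
by rewrite nth_Elist // leq_subLR -addn1 addnC leq_add2r muln_gt0.
Qed.

Definition plocal (p : nat) (x : rat) : bool := coprime p `|denq x|%N.

Definition congr_plocal (p e : nat) (x y : rat) : Prop :=
  [/\ plocal p x, plocal p y &
      exists2 z : rat, plocal p z & x - y = p%:R ^+ e * z].

(* Main.v *)
(* By its exponential generating function 1 / (1 + a (cosh t - 1)), the sequence
   E_{n,a} is the moment sequence of a 3-adic measure mu on Z_3: the functional
   L x^n = E_{n,a} satisfies L (f + a/2 (f(x+1) - 2 f(x) + f(x-1))) = f(0).
   Multiplying the denominator by its conjugates under the cube roots of unity
   shows that the part of mu on 3 Z_3 is, after rescaling x = 3 y, the constant
   c = (2-a)/(2-3a) times the same kind of measure with parameter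
   a' = a^3/(2-3a)^2.  The difference is a functional [unit_part] supported on
   the units, so it maps (x^2-1)^k, which is divisible by 3^k at every integer
   prime to 3, into 3^k Z_(3).  Hence
     E_{2n,a} = 9^n c E_{2n,a'} + sum_k C(n,k) [unit_part] ((x^2-1)^k),
   and modulo 3^(ord_3 n + 5) only the terms k <= 4 survive. *)
Require Import Defs.
From HB Require Import structures.
From mathcomp Require Import all_boot all_order all_algebra.
From mathcomp Require Import ring zify.

Set Implicit Arguments.
Unset Strict Implicit.
Unset Printing Implicit Defensive.

Import Order.TTheory GRing.Theory Num.Theory.
Local Open Scope ring_scope.

(** * The ring of rationals with denominator prime to p *)

(** Any denominator prime to p will do, reduced or not: by Gauss the reduced one divides it. Closure
    under sums and products then needs only the product of two denominators. *)
Lemma plocalP (p : nat) (x : rat) :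
  reflect (exists2 d : int, coprimez p d & x * d%:~R \is a Num.int)
          (x \in plocal p).
Proof.
apply: (iffP idP) => [px|[d pd /intrP[m xd]]].
  by exists (denq x); rewrite // -numqE intr_int.
have : (denq x %| numq x * d)%Z.
  apply/dvdzP; exists m; apply: (@intr_inj rat).
  by rewrite !rmorphM /= -xd numqE mulrAC.
rewrite Gauss_dvdzr; last by rewrite /coprimez gcdzC; exact: coprime_num_den.
by move=> dvd_d; exact: coprime_dvdr dvd_d pd.
Qed.

Lemma plocal_subring (p : nat) : subring_closed (plocal p).
Proof.
split=> [|x y /plocalP[d pd xd] /plocalP[e pe ye]|
          x y /plocalP[d pd xd] /plocalP[e pe ye]].
- by apply/plocalP; exists 1; rewrite ?mulr1 ?rpred1 // /coprimez gcdz1.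
- apply/plocalP; exists (d * e); first by rewrite coprimezMr pd.
  have -> : (x - y) * (d * e)%:~R =
            x * d%:~R * e%:~R - y * e%:~R * d%:~R by rewrite rmorphM /=; ring.
  by apply: rpredB; apply: rpredM => //; exact: rpred_int.
- apply/plocalP; exists (d * e); first by rewrite coprimezMr pd.
  have -> : x * y * (d * e)%:~R =
            x * d%:~R * (y * e%:~R) by rewrite rmorphM /=; ring.
  by rewrite rpredM.
Qed.

HB.instance Definition _ (p : nat) :=
  GRing.isSubringClosed.Build rat (plocal p) (plocal_subring p).

Lemma plocal_int (p : nat) (m : int) : m%:~R \in plocal p.
Proof. by rewrite rpred_int. Qed.

Lemma plocalV (p : nat) (d : int) : coprimez p d -> d%:~R^-1 \in plocal p.
Proof.
move=> pd; apply/plocalP; exists d => //.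
have [->|d0] := eqVneq d 0; first by rewrite mulr0 rpred0.
by rewrite mulVf ?rpred1 // intr_eq0.
Qed.

(** * The linear functional with moments E_{n,a} *)

Section Umbral.

Variable R : comNzRingType.
Implicit Types (a b : R) (f : {poly R}).

Definition umbral a f := \sum_(i < size f) f`_i * E a i.

Lemma umbral_wide a f n : (size f <= n)%N ->
  umbral a f = \sum_(i < n) f`_i * E a i.
Proof.
move=> le_fn; rewrite /umbral (big_ord_widen n (fun i => f`_i * E a i)) //.
rewrite [RHS](bigID (fun i : 'I_n => (i < size f)%N)) /=.
rewrite [X in _ = _ + X]big1 ?addr0 // => i.
by rewrite -leqNgt => le_fi; rewrite nth_default ?mul0r.
Qed.

Lemma umbral_is_linear a : linear_for *%R (umbral a).
Proof.
move=> k f g; set n := maxn (size f) (size g).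
have le_kfg : (size (k *: f + g)%R <= n)%N.
  rewrite (leq_trans (size_polyD _ _)) // geq_max leq_maxr andbT.
  by rewrite (leq_trans (size_scale_leq _ _)) ?leq_maxl.
rewrite (umbral_wide _ le_kfg) (@umbral_wide _ f n) ?leq_maxl //.
rewrite (@umbral_wide _ g n) ?leq_maxr // mulr_sumr -big_split /=.
by apply: eq_bigr => i _; rewrite coefD coefZ mulrDl mulrA.
Qed.

HB.instance Definition _ a :=
  GRing.isLinear.Build R {poly R} R *%R (umbral a) (umbral_is_linear a).

Lemma umbralXn a n : umbral a 'X^n = E a n.
Proof.
rewrite /umbral size_polyXn (bigD1 ord_max) //= coefXn eqxx mul1r.
rewrite big1 ?addr0 // => i /eqP ne_i.
rewrite coefXn; case: eqP => [e|]; last by rewrite mul0r.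
by case: ne_i; apply: val_inj.
Qed.

(** Puts the terms that survive in (X+1)^n + (X-1)^n into the index range used by [E_rec]. *)
Lemma big_even (V : nmodType) (F : nat -> V) n :
  \sum_(i < n.+1 | ~~ odd i) F i = \sum_(0 <= k < n./2.+1) F (2 * k)%N.
Proof.
elim: n => [|n IHn]; first by rewrite big_mkcond big_ord1 big_nat1.
rewrite big_mkcond big_ord_recr /= -big_mkcond IHn negbK uphalf_half.
case: ifP => [odd_n|/negbT even_n].
  by rewrite [RHS]big_nat_recr //= mul2n doubleD -(odd_double_half n) odd_n /=
             -?addnn ?add1n //; congr (_ + F _); lia.
by rewrite addr0.
Qed.

Definition shift_poly (h : R) f := f \Po ('X + h%:P).

Definition diff2 (h : R) f := shift_poly h f + shift_poly (- h) f - f *+ 2.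

Lemma shift_polyD h k f : shift_poly h (shift_poly k f) = shift_poly (h + k) f.
Proof.
rewrite /shift_poly -comp_polyA comp_polyD comp_polyX comp_polyC.
by rewrite polyCD addrA.
Qed.

Lemma shift_poly0 f : shift_poly 0 f = f.
Proof. by rewrite /shift_poly addr0 comp_polyXr. Qed.

Lemma shift_poly_is_linear h : linear (shift_poly h).
Proof. by move=> k f g; rewrite /shift_poly comp_polyD comp_polyZ. Qed.

HB.instance Definition _ h :=
  GRing.isLinear.Build R {poly R} {poly R} *:%R (shift_poly h)
    (shift_poly_is_linear h).

Lemma diff2_is_linear h : linear (diff2 h).
Proof.
move=> k f g; rewrite /diff2 !linearP /= mulrnDl -!mul_polyC.
ring.
Qed.

HB.instance Definition _ h :=
  GRing.isLinear.Build R {poly R} {poly R} *:%R (diff2 h) (diff2_is_linear h).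

Lemma horner_shift h f x : (shift_poly h f).[x] = f.[x + h].
Proof. by rewrite horner_comp !hornerE. Qed.

(** By linearity f may be taken to be X^n. In (X+1)^n + (X-1)^n the odd terms cancel and the leading
    2X^n cancels the -2X^n of [diff2]; what remains is the recursion of E. Writing the parameter as
    2b avoids halving it in a general ring. *)
Lemma umbral_diff2 b f :
  umbral (b *+ 2) (f + b *: diff2 1 f) = f.[0].
Proof.
rewrite -[f]coefK poly_def !linear_sum -big_split /= linear_sum.
rewrite horner_sum; apply: eq_bigr => i _.
rewrite linearZ /= scalerA [b * _]mulrC -scalerA -scalerDr linearZ hornerZ /=.
congr (_ * _); move: (nat_of_ord i) => n {i}; rewrite hornerXn.
rewrite [LHS]linearD [X in _ + X]linearZ /= umbralXn /diff2.
have -> : shift_poly 1 'X^n + shift_poly (- 1) 'X^n =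
          \sum_(i < n.+1 | ~~ odd i) 'X^(n - i) *+ 'C(n, i) *+ 2 :> {poly R}.
  rewrite /shift_poly !comp_Xn_poly polyCN polyC1 !exprDn -big_split /=.
  rewrite [RHS]big_mkcond; apply: eq_bigr => i _ /=.
  rewrite expr1n mulr1 -signr_odd; case: (odd i); rewrite /= ?expr0 ?mulr1 //.
  by rewrite expr1 mulrN1 mulNrn subrr.
rewrite [X in _ * X]linearB linearMn linear_sum /= umbralXn.
rewrite (big_even (fun i => umbral (b *+ 2) ('X^(n - i) *+ 'C(n, i) *+ 2))).
rewrite big_nat_recl // muln0 subn0 bin0 !linearMn /= umbralXn addrAC subrr.
rewrite add0r; under eq_bigr do rewrite !linearMn /= umbralXn.
(* For n = 0 the recursion does not apply; the remaining sum is empty and both sides equal 1. *)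
case: n => [|n]; first by rewrite big_geq ?mulr0 ?addr0.
rewrite {1}E_rec // expr0n big_add1 /= !mulr_sumr -big_split /=.
apply: big1 => i _; rewrite -[E _ _ *+ _]mulr_natl; ring.
Qed.

End Umbral.

(** * The part of the functional carried by the 3-adic units *)

Section UnitPart.

Variables (F : fieldType) (b : F).
Implicit Types f g : {poly F}.

(* [b] stands for a/2, and then [dual_param] is a'/2. *)
Definition dual_param := b ^+ 3 / (1 - 3 * b) ^+ 2.

Definition unit_part f :=
  umbral (b *+ 2) f
  - (1 - b) / (1 - 3 * b) * umbral (dual_param *+ 2) (f \Po (3 *: 'X)).

Lemma unit_part_is_linear : linear_for *%R unit_part.
Proof.
move=> k f g; rewrite /unit_part comp_polyD comp_polyZ !linearP /=; ring.
Qed.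

HB.instance Definition _ :=
  GRing.isLinear.Build F {poly F} F *%R unit_part unit_part_is_linear.

Lemma unit_partXn n :
  unit_part 'X^n =
  E (b *+ 2) n - (1 - b) / (1 - 3 * b) * (3 ^+ n * E (dual_param *+ 2) n).
Proof.
by rewrite /unit_part comp_Xn_poly exprZn linearZ /= !umbralXn.
Qed.

(* With T the unit shift, this is the product over the cube roots of unity z of
   (1 - 2b) + b (z T + (z T)^-1); [cof] below is the product over z <> 1. *)
Definition norm_op g := (1 - 3 * b) ^+ 2 *: g + b ^+ 3 *: diff2 3 g.

(** Since [norm_op b g] is 1 + b [diff2 1] applied to [cof], the first functional returns [cof] at
    0. After x = 3y it is (1-3b)^2 times the same kind of operator with parameter [dual_param], so
    the second returns (1-3b)^2 g(0). As (1-2b)^2 - b^2 = (1-b)(1-3b), the two multiples of g(0)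
    cancel, and only values of g at integers prime to 3 are left. *)
Lemma unit_part_norm g : 1 - 3 * b != 0 ->
  unit_part (norm_op g) =
  b ^+ 2 * (g.[2] + g.[- 2]) - b * (1 - 2 * b) * (g.[1] + g.[- 1]).
Proof.
move=> b_unit; rewrite /unit_part /norm_op.
pose cof := ((1 - 2 * b) ^+ 2 - b ^+ 2) *: g
  + b ^+ 2 *: (shift_poly 2 g + shift_poly (- 2) g)
  - (b * (1 - 2 * b)) *: (shift_poly 1 g + shift_poly (- 1) g).
have normE : (1 - 3 * b) ^+ 2 *: g + b ^+ 3 *: diff2 3 g =
          cof + b *: diff2 1 cof.
  have sD h p q : shift_poly h (p + q) = shift_poly h p + shift_poly h q.
    exact: linearD.
  have sN h p : shift_poly h (- p) = - shift_poly h p by exact: linearN.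
  have sZ h k p : shift_poly h (k *: p) = k *: shift_poly h p.
    exact: linearZ.
  rewrite /diff2 /cof !(sD, sN, sZ) !shift_polyD.
  rewrite (_ : 1 + 2 = 3); last by ring.
  rewrite (_ : 1 - 2 = -1); last by ring.
  rewrite (_ : -1 + 2 = 1); last by ring.
  rewrite (_ : -1 - 2 = -3); last by ring.
  rewrite (_ : 1 + 1 = 2); last by ring.
  rewrite (_ : -1 - 1 = -2); last by ring.
  rewrite subrr addNr shift_poly0 -!mul_polyC.
  rewrite !(rmorphB, rmorphM, rmorphXn, rmorph1, rmorph_nat) /=.
  ring.
rewrite {1}normE umbral_diff2.
have -> : ((1 - 3 * b) ^+ 2 *: g + b ^+ 3 *: diff2 3 g) \Po (3 *: 'X) =
  (1 - 3 * b) ^+ 2 *: ((g \Po (3 *: 'X))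
    + dual_param *: diff2 1 (g \Po (3 *: 'X))).
  (* A translation of x by 3h is a translation of y = x/3 by h. *)
  have shift3 (h : F) : shift_poly (3 * h) g \Po (3 *: 'X) =
                  shift_poly h (g \Po (3 *: 'X)).
    rewrite /shift_poly -!comp_polyA; congr (g \Po _).
    rewrite comp_polyD comp_polyX comp_polyC comp_polyZ comp_polyX scalerDr.
    by rewrite scale_polyC.
  rewrite [RHS]scalerDr scalerA /dual_param [_ * (_ / _)]mulrC.
  rewrite divfK ?expf_neq0 //.
  rewrite comp_polyD !comp_polyZ /diff2 comp_polyB comp_polyD -!shift3.
  by rewrite mulr1 mulrN1 [(_ *+ 2) \Po _]linearMn.
rewrite linearZ /= umbral_diff2 horner_comp !hornerE !horner_shift !add0r.
by rewrite /=; field.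
Qed.

End UnitPart.

(** * Integrality of the unit part at 3 *)

(** Translation preserves degree and leading coefficient, so the top terms cancel. This drives the
    induction in [norm_op_surj]. *)
Lemma size_shift_sub (F : idomainType) (h : F) (f : {poly F}) :
  f != 0 -> (size (shift_poly h f - f)%R < size f)%N.
Proof.
move=> f0; have sz : size (shift_poly h f) = size f.
  by rewrite size_comp_poly2 // size_XaddC.
rewrite -(prednK (n := size f)) ?lt0n ?size_poly_eq0 //= ltnS.
apply/leq_sizeP => j; rewrite leq_eqVlt => /orP[/eqP <-|lt_j].
  have := lead_coef_comp f (q := 'X + h%:P).
  rewrite size_XaddC => /(_ isT).
  rewrite lead_coefXaddC expr1n mulr1 /lead_coef sz coefB => ->.
  by rewrite subrr.
by rewrite coefB !nth_default ?sz ?subrr // -(prednK (n := size f))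
           ?lt0n ?size_poly_eq0.
Qed.

Lemma size_diff2 (F : idomainType) (h : F) (f : {poly F}) :
  f != 0 -> (size (diff2 h f)%R < size f)%N.
Proof.
move=> f0; have -> : diff2 h f =
    (shift_poly h f - f) + (shift_poly (- h) f - f) by rewrite /diff2; ring.
by rewrite (leq_ltn_trans (size_polyD _ _)) // gtn_max !size_shift_sub.
Qed.

Lemma plocal_E (a : rat) n : a \in plocal 3 -> E a n \in plocal 3.
Proof.
move=> a_loc; have [m] := ubnP n; elim: m n => // m IHm n le_nm.
have [->|n_gt0] := posnP n; first by rewrite E0 rpred1.
rewrite E_rec // rpredM ?rpredN // big_nat rpred_sum // => i /andP[i_gt0 _].
by rewrite rpredM ?rpred_nat ?IHm //; lia.
Qed.

Lemma sqr_sub1_dvd3 (m : int) : ~~ (3 %| m)%Z ->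
  exists q : int, m ^+ 2 - 1 = 3 * q.
Proof.
move=> m3.
have [j [->|->]] : exists j : int, m = 3 * j + 1 \/ m = 3 * j + 2.
- by exists (m %/ 3)%Z; lia.
- by exists (3 * j ^+ 2 + 2 * j); ring.
- by exists (3 * j ^+ 2 + 4 * j + 1); ring.
Qed.

Lemma cube_sub_dvd3 (n : nat) : exists t : int, n%:Z ^+ 3 - n%:Z = 3 * t.
Proof.
have [j [->|[->|->]]] : exists j : int,
    n%:Z = 3 * j \/ n%:Z = 3 * j + 1 \/ n%:Z = 3 * j + 2.
- by exists (n%:Z %/ 3)%Z; lia.
- by exists (9 * j ^+ 3 - j); ring.
- by exists (9 * j ^+ 3 + 9 * j ^+ 2 + 2 * j); ring.
- by exists (9 * j ^+ 3 + 18 * j ^+ 2 + 11 * j + 2); ring.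
Qed.

(** Divisibility is asked of values at integers prime to 3, not of coefficients, so that it survives
    translation by 3. *)
Definition unit_multiple (k : nat) (f : {poly rat}) : Prop :=
  forall m : int, ~~ (3 %| m)%Z -> f.[m%:~R] / 3 ^+ k \in plocal 3.

Section PlocalParam.

Variable b : rat.
Hypothesis b_loc : b \in plocal 3.
Hypothesis u_loc : (1 - 3 * b)^-1 \in plocal 3.
Hypothesis u_neq0 : 1 - 3 * b != 0.

(** [norm_op] is the 3-adic unit (1-3b)^2 plus an operator that lowers the degree, hence invertible
    by induction on the size. The inverse respects [unit_multiple] because [diff2 3] samples f only
    at m and m ± 3, all prime to 3 when m is. *)
Lemma norm_op_surj k f : unit_multiple k f ->
  exists2 g, unit_multiple k g & norm_op b g = f.
Proof.
have [n le_fn] := ubnP (size f); elim: n f le_fn => // n IHn f le_fn fk.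
have [->|f0] := eqVneq f 0.
  exists 0; first by move=> m _; rewrite horner0 mul0r rpred0.
  rewrite /norm_op /diff2 /shift_poly !comp_poly0 mul0rn subr0 addr0.
  by rewrite !scaler0 addr0.
pose w := (1 - 3 * b) ^- 2.
have wE : w * (1 - 3 * b) ^+ 2 = 1 by rewrite mulVf ?expf_neq0.
have w_loc : w \in plocal 3 by rewrite /w -exprVn rpredX.
have bw_loc : w * b ^+ 3 \in plocal 3 by rewrite rpredM ?rpredX.
(* The first approximation w f is sent to f + w b^3 [diff2 3 f]; the induction hypothesis corrects
   the error. *)
have [||g gk gE] := IHn (- (w * b ^+ 3) *: diff2 3 f).
- rewrite (leq_ltn_trans (size_scale_leq _ _)) //.
  by rewrite (leq_trans (size_diff2 _ f0)).
- move=> m m3; rewrite hornerZ -mulrA rpredM ?rpredN //.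
  rewrite /diff2 hornerD hornerN hornerMn hornerD !horner_shift.
  rewrite !mulrBl mulrDl mulrnAl.
  rewrite rpredB ?rpredD ?rpredMn ?fk //.
    by rewrite -(intrD _ m 3) fk //; lia.
  by rewrite -(intrB _ m 3) fk //; lia.
exists (w *: f + g).
  by move=> m m3; rewrite !hornerE mulrDl rpredD ?gk // -mulrA rpredM ?fk.
have -> : norm_op b (w *: f + g) =
          w *: norm_op b f + norm_op b g.
  rewrite /norm_op [diff2 3 _]linearP /= -!mul_polyC; ring.
rewrite gE /norm_op scalerDr !scalerA wE scale1r scaleNr.
by rewrite addrK.
Qed.

(** Write f as [norm_op b g]; then [unit_part_norm] involves only g(±1) and g(±2), each divisible by
    3^k. *)
Lemma unit_part_multiple k f : unit_multiple k f ->
  unit_part b f / 3 ^+ k \in plocal 3.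
Proof.
move=> /norm_op_surj[g gk <-]; rewrite unit_part_norm // mulrBl.
have g_loc (m : int) : ~~ (3 %| m)%Z -> (g.[m%:~R] + g.[- m%:~R]) / 3 ^+ k
    \in plocal 3.
  by move=> m3; rewrite mulrDl rpredD ?gk // -rmorphN gk // rpredN.
rewrite -!(mulrA _ _ (3 ^+ k)^-1); apply: rpredB; apply: rpredM.
- exact: rpredX.
- exact: (g_loc 2).
- by rewrite rpredM ?rpredB ?rpred1 ?rpredM ?rpred_nat.
- exact: (g_loc 1).
Qed.

Lemma unit_multiple_sqr k : unit_multiple k (('X^2 - 1) ^+ k).
Proof.
move=> m m3; have [q qE] := sqr_sub1_dvd3 m3.
rewrite !hornerE -(rmorphXn _ 2 m) -(rmorphB _ _ 1) qE rmorphM exprMn mulrAC.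
by rewrite divff ?mul1r ?rpredX ?plocal_int // expf_neq0.
Qed.

End PlocalParam.

(** * The expansion in powers of x^2 - 1: explicit low terms, negligible high terms *)

Lemma E_even_expansion (F : fieldType) (b : F) n :
  E (b *+ 2) (2 * n) =
  \sum_(k < n.+1) 'C(n, k)%:R * unit_part b (('X^2 - 1) ^+ k)
  + 3 ^+ (2 * n) * ((1 - b) / (1 - 3 * b) * E (dual_param b *+ 2) (2 * n)).
Proof.
have -> : \sum_(k < n.+1) 'C(n, k)%:R * unit_part b (('X^2 - 1) ^+ k) =
          unit_part b 'X^(2 * n).
  rewrite exprM -{2}['X^2](subrK 1) [_ - 1 + 1]addrC exprDn linear_sum.
  apply: eq_bigr => k _.
  by rewrite expr1n mul1r linearMn /= mulr_natl.
by rewrite unit_partXn; ring.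
Qed.

Lemma E_small (R : comNzRingType) (a : R) :
  [/\ E a 2 = - a, E a 4 = - a + 6 * a ^+ 2,
      E a 6 = - a + 30 * a ^+ 2 - 90 * a ^+ 3 &
      E a 8 = - a + 126 * a ^+ 2 - 1260 * a ^+ 3 + 2520 * a ^+ 4].
Proof.
have [red2 red4 red6 red8] :
  [/\ 2 * 1 = 2, 2 * 2 = 4, 2 * 3 = 6 & 2 * 4 = 8]%N by [].
have E2 : E a 2 = - a.
  by rewrite E_rec // big_nat1 red2 subnn binn E0 !mulr1.
have E4 : E a 4 = - a + 6 * a ^+ 2.
  rewrite (E_rec a (isT : 0 < 4)%N); do 1 (rewrite big_ltn; last by []).
  rewrite big_nat1 red2 red4 subnn binn.
  have [-> ->] : (4 - 2 = 2)%N /\ 'C(4, 2) = 6%N by [].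
  by rewrite E2 E0; ring.
have E6 : E a 6 = - a + 30 * a ^+ 2 - 90 * a ^+ 3.
  rewrite (E_rec a (isT : 0 < 6)%N); do 2 (rewrite big_ltn; last by []).
  rewrite big_nat1 red2 red4 red6 subnn binn.
  have [-> ->] : (6 - 2 = 4)%N /\ (6 - 4 = 2)%N by [].
  have [-> ->] : 'C(6, 2) = 15%N /\ 'C(6, 4) = 15%N by [].
  by rewrite E4 E2 E0; ring.
split=> //.
rewrite (E_rec a (isT : 0 < 8)%N); do 3 (rewrite big_ltn; last by []).
rewrite big_nat1 red2 red4 red6 red8 subnn binn.
have [-> -> ->] : [/\ 8 - 2 = 6, 8 - 4 = 4 & 8 - 6 = 2]%N by [].
have [-> -> ->] : [/\ 'C(8, 2) = 28, 'C(8, 4) = 70 & 'C(8, 6) = 28]%N by [].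
by rewrite E6 E4 E2 E0; ring.
Qed.

Lemma bin_small_field (F : numFieldType) (n : nat) : let x : F := n%:R in
  [/\ 'C(n, 2)%:R = x * (x - 1) / 2,
      'C(n, 3)%:R = x * (x - 1) * (x - 2) / 6 &
      'C(n, 4)%:R = x * (x - 1) * (x - 2) * (x - 3) / 24].
Proof.
move=> x; have step k : 'C(n, k.+1)%:R = (x - k%:R) * 'C(n, k)%:R / k.+1%:R.
  apply: (canRL (mulfK _)); rewrite ?pnatr_eq0 // mulrC -natrM mul_bin_left.
  have [le_kn|lt_nk] := leqP k n; first by rewrite natrM natrB.
  by rewrite bin_small // muln0 mulr0.
by split; rewrite !step bin0; field.
Qed.

(** Since C(n,k) = (n/k) C(n-1,k-1), the order of C(n,k) 3^k at 3 is at least ord n + k - ord k, and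
    k - ord k >= 5 once k >= 5. *)
Lemma high_term_plocal (n k : nat) : (0 < n)%N -> (5 <= k)%N ->
  'C(n, k)%:R * 3 ^+ k / 3 ^+ (logn 3 n + 5) \in plocal 3.
Proof.
move=> n_gt0 k_ge5.
have [n' _ nE] := pfactor_coprime (isT : prime 3) n_gt0.
have k_gt0 : (0 < k)%N by lia.
have [k' k'_cop kE] := pfactor_coprime (isT : prime 3) k_gt0.
have le_k : (logn 3 k + 5 <= k)%N.
  (* Order 0 is the hypothesis k >= 5, order 1 forces k >= 6, and for an order r >= 2 one has k >=
     3^r >= r + 5. *)
  case: (logn 3 k) kE => [|[|j]] kE; [by []|lia|].
  suff le_pow : (j.+2 + 5 <= 3 ^ j.+2)%N.
    apply: (leq_trans le_pow); rewrite kE leq_pmull //; lia.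
  elim: j {kE} => // j IHj; rewrite expnS; lia.
have k'0 : k'%:R != 0 :> rat by rewrite pnatr_eq0; apply/eqP; lia.
have -> : 'C(n, k)%:R * 3 ^+ k / 3 ^+ (logn 3 n + 5) =
    (n' * 'C(n.-1, k.-1))%:R * 3 ^+ (k - (logn 3 k + 5)) / k'%:R :> rat.
  have binE : k%:R * 'C(n, k)%:R = n%:R * 'C(n.-1, k.-1)%:R :> rat.
    by rewrite -!natrM mul_bin_diag prednK.
  have -> : 'C(n, k)%:R = n%:R * 'C(n.-1, k.-1)%:R / k%:R :> rat.
    by rewrite -binE mulrC mulKf // pnatr_eq0 -lt0n.
  rewrite -[X in 3 ^+ X](subnK le_k) {1}nE [X in _ / X%:R * _]kE !exprD !natrM.
  rewrite !natrX; field.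
  by rewrite k'0 !expf_neq0.
rewrite rpredM ?rpredM ?rpred_nat ?rpredX ?rpred_nat //.
by apply: (@plocalV 3 k').
Qed.

(* Found by clearing denominators in the truncated expansion, reducing its
   coefficients modulo 3^6, and dividing what is left by the monic polynomials
   a^2 - 1 = 3 s and n^3 - n = 3 t. *)
Definition trunc_quo (R : comNzRingType) (a n s t : R) : R :=
  (- 28 - 28 * n + 21 * n ^+ 2)
  + (114 + 107 * n - 103 * n ^+ 2) * a
  + (- 100 - 109 * n + 200 * n ^+ 2) * a ^+ 2
  + (- 54 - 72 * n - 196 * n ^+ 2 - 11 * n ^+ 3) * a ^+ 3
  + (- 268 + 750 * n - 161 * n ^+ 2 + 75 * n ^+ 3) * a ^+ 4
  + (1072 - 2039 * n + 944 * n ^+ 2 - 193 * n ^+ 3) * a ^+ 5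
  + (- 1189 + 2420 * n - 1259 * n ^+ 2 + 220 * n ^+ 3) * a ^+ 6
  + (456 - 1035 * n + 560 * n ^+ 2 - 93 * n ^+ 3) * a ^+ 7
  + (- 1 + n ^+ 2 - a * n ^+ 2)
  + a * t
  + (- 3 + n + 5 * n ^+ 2 + 2 * a + a * n - 4 * a * n ^+ 2) * s
  - 4 * s * t
  + (- 7 - n + 12 * n ^+ 2 + 4 * a - 4 * a * n ^+ 2) * s ^+ 2
  + (- 12 - 18 * a) * s ^+ 2 * t
  + (- 9 + 9 * n ^+ 2) * s ^+ 3
  - 27 * a * s ^+ 3 * t.

Lemma trunc_quo_intr (R : comNzRingType) (a n s t : int) :
  trunc_quo (a%:~R : R) n%:~R s%:~R t%:~R = (trunc_quo a n s t)%:~R.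
Proof. by rewrite /trunc_quo; ring. Qed.

Lemma unit_part_sqr_small (F : fieldType) (b : F) (e : nat -> F) :
  (forall k, unit_part b 'X^k = e k) ->
  [/\ unit_part b (('X^2 - 1) ^+ 0) = e 0%N,
      unit_part b (('X^2 - 1) ^+ 1) = e 2 - e 0%N,
      unit_part b (('X^2 - 1) ^+ 2) = e 4 - 2 * e 2 + e 0%N,
      unit_part b (('X^2 - 1) ^+ 3) = e 6 - 3 * e 4 + 3 * e 2 - e 0%N &
      unit_part b (('X^2 - 1) ^+ 4) =
        e 8 - 4 * e 6 + 6 * e 4 - 4 * e 2 + e 0%N].
Proof.
move=> eE.
have uD f g : unit_part b (f + g) = unit_part b f + unit_part b g.
  exact: raddfD.
have uB f g : unit_part b (f - g) = unit_part b f - unit_part b g.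
  exact: raddfB.
have uM m f : unit_part b (m%:R * f) = m%:R * unit_part b f.
  by rewrite !mulr_natl; exact: raddfMn.
split; first by rewrite -eE !expr0.
(* Folding each combination back into a single argument of [unit_part] leaves a polynomial
   identity. *)
all: rewrite -!eE !(=^~ uM, =^~ uB, =^~ uD);
  apply: (congr1 (unit_part b)); ring.
Qed.

(** An exact identity that displays the modulus: n carries 3^(ord n), 243 is 3^5 and 8 is a unit at
    3. The bracket multiplied by c collects the a'^2 part of 3^4 E_{4,a'} together with the terms in
    3^6 E_{6,a'} and 3^8 E_{8,a'}. *)
Lemma low_terms (F : numFieldType) (a : F) (m : nat) : 2 - 3 * a != 0 ->
  let n : F := m%:R in
  let c := (2 - a) / (2 - 3 * a) in
  let a' := a ^+ 3 / (2 - 3 * a) ^+ 2 in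
  \sum_(k < 5) 'C(m, k)%:R * unit_part (a / 2) (('X^2 - 1) ^+ k)
  - (2 * a / (3 * a - 2)
     + (54 * a ^+ 3 - 99 * a ^+ 2 + 27 * a - 81) * n ^+ 3
     - (9 * a ^+ 4 - 27 * a ^+ 3 - 63 * a ^+ 2 - 81 * a - 108) * n ^+ 2
     - (117 * a ^+ 4 + 117 * a ^+ 3 + 111 * a ^+ 2 - 54 * a - 108) * n)
  = n * 243 / 8 *
    (trunc_quo a n ((a ^+ 2 - 1) / 3) ((n ^+ 3 - n) / 3) / (2 - 3 * a) ^+ 3
     - c * (4 * a' ^+ 2 * (2 * (n - 1) - 2 * (n - 1) * (n - 2)
                           + (n - 1) * (n - 2) * (n - 3))
            + 4 * E a' 6 * ((n - 1) * (n - 2) - (n - 1) * (n - 2) * (n - 3))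
            + 9 * E a' 8 * ((n - 1) * (n - 2) * (n - 3)))).
Proof.
move=> u0 n c a'.
have sum5 (G : nat -> F) :
    \sum_(k < 5) G k = G 0%N + G 1%N + G 2 + G 3 + G 4.
  by rewrite !big_ord_recr big_ord0 /= add0r.
rewrite (sum5 (fun k => 'C(m, k)%:R * unit_part (a / 2) (('X^2 - 1) ^+ k))).
have b2 : a / 2 *+ 2 = a by rewrite -mulr_natr divfK ?pnatr_eq0.
have bu : 1 - 3 * (a / 2) = (2 - 3 * a) / 2 by field.
have cE : (1 - a / 2) / (1 - 3 * (a / 2)) = c by rewrite bu /c; field.
have a'E : dual_param (a / 2) *+ 2 = a'.
  by rewrite /dual_param bu /a' -mulr_natr; field.
have eE k : unit_part (a / 2) 'X^k = E a k - c * (3 ^+ k * E a' k).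
  by rewrite unit_partXn b2 cE a'E.
have [-> -> -> -> ->] := unit_part_sqr_small eE.
have [-> -> ->] := bin_small_field F m; rewrite bin0 bin1 -/n !E0.
have [-> -> -> ->] := E_small a; have [-> -> _ _] := E_small a'.
(* These moments can stay opaque: their prefactors 3^6 and 3^8, even over the denominators 6 and 24
   of the binomials, already contain 3^5. *)
move: (E a' 6) (E a' 8) => e6 e8.
have u0' : 3 * a - 2 != 0 by rewrite -opprB oppr_eq0.
rewrite /trunc_quo /c /a'; field.
by rewrite u0 u0'.
Qed.

(** * Assembling the congruence *)

Lemma coprimez3 (m : int) : ~~ (3 %| m)%Z -> coprimez 3%N m.
Proof. by rewrite coprimezE prime_coprime. Qed.

Lemma plocal_mul_exp3 (x : rat) (e f : nat) : (e <= f)%N ->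
  x \in plocal 3 -> 3 ^+ f * x / 3 ^+ e \in plocal 3.
Proof.
move=> le_ef x_loc; rewrite -(subnK le_ef) exprD mulrAC mulfK ?expf_neq0 //.
by rewrite rpredM ?rpredX ?rpred_nat.
Qed.

(** Makes the 9^n term negligible. Equality holds at n = 3; beyond that, ord n < 3^(ord n) <= n
    suffices. The bound fails at n = 2. *)
Lemma logn3_add5 n : (3 <= n)%N -> (logn 3 n + 5 <= 2 * n)%N.
Proof.
rewrite leq_eqVlt => /orP[/eqP <- //|n_gt3].
have : (3 ^ logn 3 n <= n)%N by rewrite dvdn_leq ?pfactor_dvdnn //; lia.
by move/(leq_trans (ltn_expl (logn 3 n) (isT : 1 < 3)%N)); lia.
Qed.

(** Both sums may run past n, where the binomials vanish; no comparison of m with n is required. *)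
Lemma sum_bin_split (R : pzSemiRingType) (G : nat -> R) m n : (0 < m)%N ->
  \sum_(k < n.+1) 'C(n, k)%:R * G k =
  \sum_(k < m) 'C(n, k)%:R * G k
  + \sum_(k < n) 'C(n, m + k)%:R * G (m + k)%N.
Proof.
move=> m_gt0; have lt_n : (n < m + n)%N by rewrite -[ltnLHS]add0n ltn_add2r.
rewrite (big_ord_widen (m + n) (fun k => 'C(n, k)%:R * G k)) //.
transitivity (\sum_(k < m + n) 'C(n, k)%:R * G k); last exact: big_split_ord.
rewrite big_mkcond; apply: eq_bigr => k _; rewrite ltnS.
by case: leqP => // lt_nk; rewrite bin_small ?mul0r.
Qed.

(** Integrality of the bracket multiplied by c in [low_terms]. *)
Lemma plocal_discarded (p : nat) (y w z6 z8 : rat) :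
  y \in plocal p -> w \in plocal p -> z6 \in plocal p -> z8 \in plocal p ->
  4 * w ^+ 2 * (2 * (y - 1) - 2 * (y - 1) * (y - 2)
                + (y - 1) * (y - 2) * (y - 3))
  + 4 * z6 * ((y - 1) * (y - 2) - (y - 1) * (y - 2) * (y - 3))
  + 9 * z8 * ((y - 1) * (y - 2) * (y - 3)) \in plocal p.
Proof.
move=> y_loc w_loc z6_loc z8_loc.
have y_sub k : y - k%:R \in plocal p by exact: rpredB y_loc (rpred_nat _ _).
have y12 : (y - 1) * (y - 2) \in plocal p by exact: rpredM (y_sub 1) (y_sub 2).
have y123 : (y - 1) * (y - 2) * (y - 3) \in plocal p.
  exact: rpredM y12 (y_sub 3).
apply: rpredD; [apply: rpredD|]; apply: rpredM.
- by apply: rpredM; [exact: rpred_nat | exact: rpredX].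
- apply: rpredD y123; apply: rpredB.
    exact: rpredM (rpred_nat _ _) (y_sub 1).
  exact: rpredM (rpredM (rpred_nat _ _) (y_sub 1)) (y_sub 2).
- exact: rpredM (rpred_nat _ _) z6_loc.
- exact: rpredB y12 y123.
- exact: rpredM (rpred_nat _ _) z8_loc.
- exact: y123.
Qed.

Lemma cancel_243 (F : numFieldType) (y w : F) v :
  y * 243 / 8 * w / 3 ^+ (v + 5) = y / 3 ^+ v * (8^-1 * w).
Proof. by rewrite exprD; field; rewrite expf_neq0 ?pnatr_eq0. Qed.

Lemma target_intr (F : fieldType) (a : int) (y : F) : let x : F := a%:~R in
  (2 * a)%:~R / (3 * a - 2)%:~R
     + (54 * a ^+ 3 - 99 * a ^+ 2 + 27 * a - 81)%:~R * y ^+ 3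
     - (9 * a ^+ 4 - 27 * a ^+ 3 - 63 * a ^+ 2 - 81 * a - 108)%:~R * y ^+ 2
     - (117 * a ^+ 4 + 117 * a ^+ 3 + 111 * a ^+ 2 - 54 * a - 108)%:~R * y =
  2 * x / (3 * x - 2)
     + (54 * x ^+ 3 - 99 * x ^+ 2 + 27 * x - 81) * y ^+ 3
     - (9 * x ^+ 4 - 27 * x ^+ 3 - 63 * x ^+ 2 - 81 * x - 108) * y ^+ 2
     - (117 * x ^+ 4 + 117 * x ^+ 3 + 111 * x ^+ 2 - 54 * x - 108) * y.
Proof.
move=> x.
have -> : (2 * a)%:~R = 2 * x by rewrite /x; ring.
have -> : (3 * a - 2)%:~R = 3 * x - 2 by rewrite /x; ring.
by rewrite /x; ring.
Qed.

Theorem theorem4p2 (a : int) (n : nat) (ha0 : a != 0)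
    (ha3 : ~~ (3 %| a)%Z) (hn : (3 <= n)%N) :
  congr_plocal 3 (logn 3 n + 5)
    (E (a%:~R : rat) (2 * n))
    ((2 * a)%:~R / (3 * a - 2)%:~R
     + (54 * a ^+ 3 - 99 * a ^+ 2 + 27 * a - 81)%:~R * n%:R ^+ 3
     - (9 * a ^+ 4 - 27 * a ^+ 3 - 63 * a ^+ 2 - 81 * a - 108)%:~R * n%:R ^+ 2
     - (117 * a ^+ 4 + 117 * a ^+ 3 + 111 * a ^+ 2 - 54 * a - 108)%:~R * n%:R).
Proof.
have n_gt0 : (0 < n)%N by lia.
pose x : rat := a%:~R; pose y : rat := n%:R.
pose u := 2 - 3 * x; pose b := x / 2.
have x_loc : x \in plocal 3 by exact: plocal_int.
have y_loc : y \in plocal 3 by exact: rpred_nat.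
have uE : u = (2 - 3 * a)%:~R by rewrite /u /x; ring.
have u_loc : u^-1 \in plocal 3.
  rewrite uE; apply: plocalV; apply: coprimez3; lia.
have v_loc : (3 * a - 2)%:~R^-1 \in plocal 3.
  by apply: plocalV; apply: coprimez3; lia.
have u0 : u != 0 by rewrite uE intr_eq0; apply/eqP; lia.
have two_loc : 2^-1 \in plocal 3 by exact: (@plocalV 3 2).
have b_loc : b \in plocal 3 by rewrite rpredM.
have b2 : b *+ 2 = x by rewrite -mulr_natr divfK.
have bu : 1 - 3 * b = u / 2 by rewrite /b /u; field.
have bu_loc : (1 - 3 * b)^-1 \in plocal 3.
  by rewrite bu invf_div rpredM ?rpred_nat.
have bu0 : 1 - 3 * b != 0 by rewrite bu mulf_neq0 ?invr_eq0.
pose c := (2 - x) / u; pose x' := x ^+ 3 / u ^+ 2.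
have cE : (1 - b) / (1 - 3 * b) = c by rewrite bu /b /c; field.
have x'E : dual_param b *+ 2 = x'.
  by rewrite /dual_param bu /b /x' -mulr_natr; field.
have c_loc : c \in plocal 3 by rewrite rpredM ?rpredB ?rpred_nat.
have x'_loc : x' \in plocal 3 by rewrite /x' -exprVn rpredM ?rpredX.
have E'_loc k : E x' k \in plocal 3 by exact: plocal_E x'_loc.
set e := (logn 3 n + 5)%N.
set rhs := (X in congr_plocal _ _ _ X).
pose d k := unit_part b (('X^2 - 1) ^+ k).
pose rhs' := 2 * x / (3 * x - 2)
     + (54 * x ^+ 3 - 99 * x ^+ 2 + 27 * x - 81) * y ^+ 3
     - (9 * x ^+ 4 - 27 * x ^+ 3 - 63 * x ^+ 2 - 81 * x - 108) * y ^+ 2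
     - (117 * x ^+ 4 + 117 * x ^+ 3 + 111 * x ^+ 2 - 54 * x - 108) * y.
have rhsE : rhs = rhs'.
  exact: target_intr.
have low_loc : (\sum_(k < 5) 'C(n, k)%:R * d k - rhs) / 3 ^+ e \in plocal 3.
  have y_div : y / 3 ^+ logn 3 n \in plocal 3.
    have [n' _ nE] := pfactor_coprime (isT : prime 3) n_gt0.
    by rewrite /y {1}nE natrM natrX mulfK ?expf_neq0 // rpred_nat.
  (* The condition that 3 does not divide a gives s, and Fermat's little theorem gives t; this
     removes the divisions by 3 in the arguments of [trunc_quo]. *)
  have [s sE] : exists s : int, x ^+ 2 - 1 = 3 * s%:~R.
    have [s sE] := sqr_sub1_dvd3 ha3; exists s.
    by rewrite /x -[3]/(3%:~R) -rmorphM -sE; ring.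
  have [t tE] : exists t : int, y ^+ 3 - y = 3 * t%:~R.
    have [t tE] := cube_sub_dvd3 n; exists t.
    by rewrite -[3]/(3%:~R) -rmorphM -tE /y; ring.
  have Q_loc : trunc_quo x y ((x ^+ 2 - 1) / 3) ((y ^+ 3 - y) / 3) \in plocal 3.
    rewrite sE tE !(mulrC 3) !mulfK // /y -[n%:R]/(n%:Z%:~R) trunc_quo_intr.
    exact: plocal_int.
  have -> : \sum_(k < 5) 'C(n, k)%:R * d k - rhs = y * 243 / 8 *
    (trunc_quo x y ((x ^+ 2 - 1) / 3) ((y ^+ 3 - y) / 3) / u ^+ 3
     - c * (4 * x' ^+ 2 * (2 * (y - 1) - 2 * (y - 1) * (y - 2)
                           + (y - 1) * (y - 2) * (y - 3))
            + 4 * E x' 6 * ((y - 1) * (y - 2) - (y - 1) * (y - 2) * (y - 3))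
            + 9 * E x' 8 * ((y - 1) * (y - 2) * (y - 3)))).
    by rewrite rhsE; exact: low_terms.
  rewrite cancel_243; apply: rpredM y_div _; apply: rpredM.
    exact: (@plocalV 3 8).
  apply: rpredB.
    by apply: rpredM Q_loc _; rewrite -exprVn; exact: rpredX u_loc.
  apply: rpredM c_loc _.
  exact: plocal_discarded.
have high_loc :
    (\sum_(k < n) 'C(n, 5 + k)%:R * d (5 + k)%N) / 3 ^+ e \in plocal 3.
  rewrite mulr_suml; apply: rpred_sum => k _.
  (* The factor 3^(5+k) is moved from the unit part, which is divisible by it, to the binomial,
     which needs it to absorb the modulus. *)
  have -> : 'C(n, 5 + k)%:R * d (5 + k)%N / 3 ^+ e =
      'C(n, 5 + k)%:R * 3 ^+ (5 + k) / 3 ^+ e * (d (5 + k)%N / 3 ^+ (5 + k)).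
    by field; rewrite !expf_neq0.
  apply: rpredM; first exact: high_term_plocal.
  exact: (unit_part_multiple b_loc bu_loc bu0 (unit_multiple_sqr _)).
have EE : E x (2 * n) = \sum_(k < 5) 'C(n, k)%:R * d k
    + \sum_(k < n) 'C(n, 5 + k)%:R * d (5 + k)%N
    + 3 ^+ (2 * n) * (c * E x' (2 * n)).
  rewrite -b2 E_even_expansion cE x'E; congr (_ + _).
  exact: (@sum_bin_split _ d 5).
split; first exact: plocal_E x_loc.
  apply: rpredB; [apply: rpredB; [apply: rpredD|]|].
  - apply: rpredM; first exact: plocal_int.
    exact: v_loc.
  - by apply: rpredM; [exact: plocal_int | exact: rpredX].
  - by apply: rpredM; [exact: plocal_int | exact: rpredX].
  - by apply: rpredM; [exact: plocal_int | exact: y_loc].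
exists ((E x (2 * n) - rhs) / 3 ^+ e); last first.
  by rewrite mulrC divfK ?expf_neq0.
(* Three pieces are integral separately: the low terms minus the target, the high terms, and the 9^n
   term. *)
rewrite EE addrAC [X in (X + _) / _]addrAC mulrDl.
apply: rpredD; first by rewrite mulrDl; exact: rpredD low_loc high_loc.
apply: plocal_mul_exp3; first exact: logn3_add5.
exact: rpredM c_loc (E'_loc _).
Qed.
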